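(* Let $a>0$ and let $L:\mathbb{R}^n\times\mathbb{R}^m\to[-\infty,+\infty]$ be a proper closed $a$-strongly convex-concave function. Let $\mathbb{R}^n\times\mathbb{R}^m=\mathbb{R}^{n+m}$ be decomposed into $\alpha\ge1$ blocks, $\mathbb{R}^{n+m}=\prod_{i=1}^\alpha\mathbb{R}^{n_i}$ with $\sum_{i=1}^\alpha n_i=n+m$. Then: 1. $L$ has a unique saddle point $(x^*,y^* )$. 2. Let $c>0$ satisfy $c\ge\frac{\sqrt\alpha-1}{a}$, and let $F=(I+cT_L)^{-1}$ (a single-valued mapping from $\mathbb{R}^n\times\mathbb{R}^m$ into $\mathbb{R}^n\times\mathbb{R}^m$). Then any parallel asynchronous algorithm with bounded delays associated with $F$ converges to the saddle point $(x^*,y^* )$ of $L$.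
   Context: A saddle point of $L$ is $(x^*,y^* )\in\mathbb{R}^n\times\mathbb{R}^m$ with $L(x^*,y)\le L(x^*,y^* )\le L(x,y^* )$ for all $(x,y)\in\mathbb{R}^n\times\mathbb{R}^m$. ''Proper closed'' is in Rockafellar's terminology for saddle functions (functions convex in $x$ and concave in $y$): $L$ is proper if there exist $x_0,y_0$ with $L(x_0,y)<+\infty$ for all $y$ and $L(x,y_0)>-\infty$ for all $x$. Let $\mathrm{cl}_1L$ be obtained by taking, for each $y$, the convex closure of $L(\cdot,y)$ (the lower semicontinuous hull if that hull never takes the value $-\infty$, and the constant $-\infty$ otherwise), and $\mathrm{cl}_2L$ by taking, for each $x$, the concave closure of $L(x,\cdot)$ (the negative of the convex closure of $-L(x,\cdot)$). Two saddle functions are equivalent if they have the same $\mathrm{cl}_1$ and the same $\mathrm{cl}_2$; $L$ is closed if $\mathrm{cl}_1L$ and $\mathrm{cl}_2L$ are both equivalent to $L$. A function $f$ is $a$-strongly convex ($a>0$) if $f(tx+(1-t)x')\le tf(x)+(1-t)f(x')-\frac12at(1-t)\|x-x'\|^2$ for all $x,x'$ and $t\in(0,1)$ (required whenever the right-hand side is not of the form $\infty-\infty$); $f$ is $a$-strongly concave if $-f$ is $a$-strongly convex. $L$ is $a$-strongly convex-concave if $L(x,y)$ is $a$-strongly convex in $x$ and $a$-strongly concave in $y$. The subdifferential $\partial L(x,y)$ is the set of $(z,t)\in\mathbb{R}^n\times\mathbb{R}^m$ such that for all $(x',y')\in\mathbb{R}^n\times\mathbb{R}^m$, $L(x,y')-\langle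 y'-y,t\rangle\le L(x,y)\le L(x',y)-\langle x'-x,z\rangle$. The multifunction $T_L$ on $\mathbb{R}^n\times\mathbb{R}^m$ is $T_L(x,y)=\{(z,t)\in\mathbb{R}^n\times\mathbb{R}^m:(z,-t)\in\partial L(x,y)\}$. The inner product on $\mathbb{R}^n\times\mathbb{R}^m$ is $\langle(x,y),(x',y')\rangle=\langle x,x'\rangle+\langle y,y'\rangle$, with the associated Euclidean norm. Parallel asynchronous algorithm associated with $F=(F_1,\dots,F_\alpha):\prod_{i=1}^\alpha\mathbb{R}^{n_i}\to\prod_{i=1}^\alpha\mathbb{R}^{n_i}$: given an initial point $w^0$, a sequence $\{J(p)\}_{p\in\mathbb{N}}$ of nonempty subsets of $\{1,\dots,\alpha\}$ and a sequence $\{(s_1(p),\dots,s_\alpha(p))\}_{p\in\mathbb{N}}$ in $\mathbb{N}^\alpha$, it generates for $p=0,1,\dots$ and $i=1,\dots,\alpha$: $w_i^{p+1}=w_i^p$ if $i\notin J(p)$, and $w_i^{p+1}=F_i(w_1^{s_1(p)},\dots,w_\alpha^{s_\alpha(p)})$ if $i\in J(p)$. It has bounded delays if there is $s\in\mathbb{N}$ with $p-s\le s_i(p)\le p$ for all $i\in\{1,\dots,\alpha\}$ and all $p\in\mathbb{N}$.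
   Formalization: The formal theorem adds that every block i belongs to J(p) for infinitely many p; with J(p) only nonempty, part 2 fails (L = a x²/2 − a y²/2, J(p) = {1} for all p, w⁰ = (1,1): the second block never moves). *)

(* Defs.v *)
From HB Require Import structures.
From mathcomp Require Import all_boot all_order all_algebra.
From mathcomp Require Import all_classical all_reals all_analysis.
Import Order.TTheory GRing.Theory Num.Theory.
Import numFieldNormedType.Exports.

Set Implicit Arguments.
Unset Strict Implicit.
Unset Printing Implicit Defensive.

Local Open Scope classical_set_scope.
Local Open Scope ring_scope.
Local Open Scope ereal_scope.

(* The library's norm on 'rV_n is the sup norm, hence these two definitions;  *)
(* its topology on 'rV_n is the product one, i.e. the Euclidean topology.     *)
Definition dotp (R : realType) (n : nat) (u v : 'rV[R]_n) : R :=
  (\sum_(i < n) u ord0 i * v ord0 i)%R.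

Definition enorm (R : realType) (n : nat) (u : 'rV[R]_n) : R :=
  Num.sqrt (dotp u u).

(* In \bar R, +oo + -oo is given the value -oo; the guard [adde_def] keeps    *)
(* the inequality from being required where the right-hand side is undefined. *)
Definition strongly_convex (R : realType) (n : nat) (a : R)
    (f : 'rV[R]_n -> \bar R) : Prop :=
  forall (x x' : 'rV[R]_n) (t : R), (0 < t < 1)%R ->
    adde_def (t%:E * f x) ((1 - t)%:E * f x') ->
    f (t *: x + (1 - t) *: x')%R <=
      t%:E * f x + (1 - t)%:E * f x'
      - (2^-1 * a * t * (1 - t) * enorm (x - x') ^+ 2)%:E.

Definition strongly_concave (R : realType) (n : nat) (a : R)
    (f : 'rV[R]_n -> \bar R) : Prop :=
  strongly_convex a (fun x => - f x).

Definition strongly_convex_concave (R : realType) (n m : nat) (a : R)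
    (L : 'rV[R]_n -> 'rV[R]_m -> \bar R) : Prop :=
  (forall y, strongly_convex a (fun x => L x y)) /\
  (forall x, strongly_concave a (L x)).

Definition lsc_hull (R : realType) (n : nat) (f : 'rV[R]_n -> \bar R)
    (x : 'rV[R]_n) : \bar R :=
  ereal_sup [set g x | g in [set g : 'rV[R]_n -> \bar R |
    lower_semicontinuous g /\ forall z, g z <= f z]].

Definition convex_closure (R : realType) (n : nat) (f : 'rV[R]_n -> \bar R) :
    'rV[R]_n -> \bar R :=
  if `[< forall x, lsc_hull f x != -oo >] then lsc_hull f else cst -oo.

Definition concave_closure (R : realType) (n : nat) (f : 'rV[R]_n -> \bar R)
    (x : 'rV[R]_n) : \bar R :=
  - convex_closure (fun z => - f z) x.

Definition cl1 (R : realType) (n m : nat) (L : 'rV[R]_n -> 'rV[R]_m -> \bar R) :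
    'rV[R]_n -> 'rV[R]_m -> \bar R :=
  fun x y => convex_closure (fun x' => L x' y) x.

Definition cl2 (R : realType) (n m : nat) (L : 'rV[R]_n -> 'rV[R]_m -> \bar R) :
    'rV[R]_n -> 'rV[R]_m -> \bar R :=
  fun x y => concave_closure (L x) y.

Definition saddle_equiv (R : realType) (n m : nat)
    (K L : 'rV[R]_n -> 'rV[R]_m -> \bar R) : Prop :=
  cl1 K =2 cl1 L /\ cl2 K =2 cl2 L.

Definition saddle_closed (R : realType) (n m : nat)
    (L : 'rV[R]_n -> 'rV[R]_m -> \bar R) : Prop :=
  saddle_equiv (cl1 L) L /\ saddle_equiv (cl2 L) L.

Definition saddle_proper (R : realType) (n m : nat)
    (L : 'rV[R]_n -> 'rV[R]_m -> \bar R) : Prop :=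
  exists x0 y0, (forall y, L x0 y < +oo) /\ (forall x, -oo < L x y0).

Definition saddle_point (R : realType) (n m : nat)
    (L : 'rV[R]_n -> 'rV[R]_m -> \bar R) (z : 'rV[R]_n * 'rV[R]_m) : Prop :=
  forall x y, L z.1 y <= L z.1 z.2 /\ L z.1 z.2 <= L x z.2.

Definition subdiff (R : realType) (n m : nat)
    (L : 'rV[R]_n -> 'rV[R]_m -> \bar R) (u : 'rV[R]_n * 'rV[R]_m) :
    set ('rV[R]_n * 'rV[R]_m) :=
  [set g | forall x' y',
    L u.1 y' - (dotp (y' - u.2) g.2)%:E <= L u.1 u.2 /\
    L u.1 u.2 <= L x' u.2 - (dotp (x' - u.1) g.1)%:E].

Definition saddle_operator (R : realType) (n m : nat)
    (L : 'rV[R]_n -> 'rV[R]_m -> \bar R) (u : 'rV[R]_n * 'rV[R]_m) :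
    set ('rV[R]_n * 'rV[R]_m) :=
  [set g | subdiff L u (g.1, (- g.2)%R)].

(* (I + c T)^{-1} as a multifunction *)
Definition resolvent (R : realType) (V : lmodType R) (c : R) (T : V -> set V)
    (w : V) : set V :=
  [set v | exists2 g, T v g & w = (v + c *: g)%R].

(* The identification of R^n x R^m = R^(n+m) with \prod_i R^(nn i), obtained  *)
(* by cutting the n + m coordinates into consecutive blocks of length nn i.   *)
Definition to_blocks (R : realType) (n m alpha : nat) (nn : 'I_alpha -> nat)
    (nnE : (\sum_(i < alpha) nn i = n + m)%N) (z : 'rV[R]_n * 'rV[R]_m) :
    forall i : 'I_alpha, 'rV[R]_(nn i) :=
  fun i => submxrow (castmx (erefl 1%N, esym nnE) (row_mx z.1 z.2)) i.

Definition of_blocks (R : realType) (n m alpha : nat) (nn : 'I_alpha -> nat)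
    (nnE : (\sum_(i < alpha) nn i = n + m)%N)
    (w : forall i : 'I_alpha, 'rV[R]_(nn i)) : 'rV[R]_n * 'rV[R]_m :=
  let v : 'rV[R]_(n + m) := castmx (erefl 1%N, nnE) (mxrow w) in
  (lsubmx v, rsubmx v).

Lemma to_blocksK (R : realType) (n m alpha : nat) (nn : 'I_alpha -> nat)
    (nnE : (\sum_(i < alpha) nn i = n + m)%N) :
  cancel (@to_blocks R n m alpha nn nnE) (of_blocks nnE).
Proof.
by case=> x y; rewrite /of_blocks /to_blocks submxrowK castmx_comp castmx_id row_mxKl row_mxKr.
Qed.

Lemma of_blocksK (R : realType) (n m alpha : nat) (nn : 'I_alpha -> nat)
    (nnE : (\sum_(i < alpha) nn i = n + m)%N)
    (w : forall i : 'I_alpha, 'rV[R]_(nn i)) (i : 'I_alpha) :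
  to_blocks nnE (of_blocks nnE w) i = w i.
Proof. by rewrite /to_blocks /of_blocks /= hsubmxK castmx_comp castmx_id mxrowK. Qed.

(* w is the sequence generated from w 0 by the parallel asynchronous          *)
(* algorithm associated with F, the update sets J and the indices s p i       *)
(* (mathematically s_i(p)).                                                   *)
Definition async_algorithm (R : realType) (alpha : nat) (nn : 'I_alpha -> nat)
    (F : (forall i, 'rV[R]_(nn i)) -> forall i, 'rV[R]_(nn i))
    (J : nat -> {set 'I_alpha}) (s : nat -> 'I_alpha -> nat)
    (w : nat -> forall i, 'rV[R]_(nn i)) : Prop :=
  (forall p, J p != finset.set0) /\
  (forall p i, w p.+1 i =
     if i \in J p then F (fun j => w (s p j) j) i else w p i).

(* p - d is truncated at 0, which is harmless since s p i >= 0. *)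
Definition bounded_delays (alpha : nat) (s : nat -> 'I_alpha -> nat) : Prop :=
  exists d : nat, forall p i, (p - d <= s p i <= p)%N.

(* The usual standing assumption on asynchronous iterations that no block is  *)
(* ever abandoned. Without it convergence can fail as soon as two blocks have *)
(* positive length: a block that is never updated keeps its initial value.    *)
Definition updated_infinitely_often (alpha : nat)
    (J : nat -> {set 'I_alpha}) : Prop :=
  forall (i : 'I_alpha) (N : nat), exists2 p, (N <= p)%N & i \in J p.

(* Main.v *)
Require Import Defs.
From HB Require Import structures.
From mathcomp Require Import all_boot all_order all_algebra.
From mathcomp Require Import all_classical all_reals all_analysis.
From mathcomp Require Import ring lra.
Import Order.TTheory GRing.Theory Num.Theory.
Import numFieldNormedType.Exports.

Set Implicit Arguments.
Unset Strict Implicit.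
Unset Printing Implicit Defensive.

Local Open Scope classical_set_scope.
Local Open Scope ring_scope.

(** Existence of a saddle point. Let G = sup_y inf_x L(x, y). By strong concavity
    the maximizing sequences of y |-> inf_x L(x, y) are Cauchy, with a limit [ys];
    by strong convexity so are the minimizing sequences of L(., ys), with a limit
    [xs], and L(x, ys) grows quadratically away from [xs]
    ([epi_strongly_convex_minimizer]). Moving from [ys] a little towards an
    arbitrary [y], the corresponding near-minimizers in [x] stay close to [xs],
    and concavity in [y] then shows that L(xs, y) cannot exceed G
    ([cl1_le_maximin]). As L need not be semicontinuous, these limits only control
    [cl1 L] and [cl2 L]. Closedness repairs this: constant bounds pass through
    closures, and cl1 (cl2 L) = cl1 L <= L <= cl2 L = cl2 (cl1 L). Closedness also
    excludes infinite G, since otherwise [cl1 L] or [cl2 L] would be a constant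
    infinity ([exists_section_bounded_below]). This is [saddle_point_exists].

    The resolvent. The points of (I + cT)^-1 (p, q) are the saddle points of
    L(x, y) + 1/(2c) |x - p|^2 - 1/(2c) |y - q|^2, which is again proper, closed
    and strongly convex-concave, so they exist ([resolvent_nonempty]). Strong
    convexity makes T strongly monotone: images v, v' of w, w' satisfy
    (1 + ca) |v - v'|^2 <= <v - v', w - w'> ([resolvent_strongly_monotone]). This
    gives uniqueness of the image and of the saddle point, the saddle points being
    fixed by the resolvent.

    Convergence. Put k = 1 + ca, let u be the error of a vector and v the error of
    its image. From k |v|^2 <= <v, u> one gets |v - u/(2k)| <= |u|/(2k), hence for
    each block |v_i| <= |u_i|/(2k) + |u|/(2k) <= rho max_j |u_j| with
    rho = (1 + sqrt alpha) / (2k) ([block_contraction]). The assumptions c > 0 and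
    c >= (sqrt alpha - 1) / a say that k > 1 and k >= sqrt alpha, so rho < 1. A
    contraction towards a fixed point in the maximum norm of the blocks tolerates
    bounded delays ([async_error_decay]). *)

(** * The Euclidean inner product *)

Lemma dotpC (R : realType) n (u v : 'rV[R]_n) : dotp u v = dotp v u.
Proof. by apply: eq_bigr => i _; rewrite mulrC. Qed.

Lemma dotpDl (R : realType) n (u v w : 'rV[R]_n) :
  dotp (u + v) w = dotp u w + dotp v w.
Proof. by rewrite /dotp -big_split; apply: eq_bigr => i _; rewrite mxE mulrDl. Qed.

Lemma dotpZl (R : realType) n k (u v : 'rV[R]_n) : dotp (k *: u) v = k * dotp u v.
Proof. by rewrite /dotp mulr_sumr; apply: eq_bigr => i _; rewrite mxE mulrA. Qed.

Lemma dotpNl (R : realType) n (u v : 'rV[R]_n) : dotp (- u) v = - dotp u v.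
Proof. by rewrite -scaleN1r dotpZl mulN1r. Qed.

Lemma dotpDr (R : realType) n (u v w : 'rV[R]_n) :
  dotp w (u + v) = dotp w u + dotp w v.
Proof. by rewrite dotpC dotpDl !(dotpC w). Qed.

Lemma dotpZr (R : realType) n k (u v : 'rV[R]_n) : dotp v (k *: u) = k * dotp v u.
Proof. by rewrite dotpC dotpZl dotpC. Qed.

Lemma dotpNr (R : realType) n (u v : 'rV[R]_n) : dotp v (- u) = - dotp v u.
Proof. by rewrite dotpC dotpNl dotpC. Qed.

Lemma dotp0 (R : realType) n (v : 'rV[R]_n) : dotp v 0 = 0.
Proof. by rewrite -(scale0r 0) dotpZr mul0r. Qed.

Definition dotpE := (dotpDl, dotpDr, dotpZl, dotpZr, dotpNl, dotpNr).

Lemma dotp_ge0 (R : realType) n (u : 'rV[R]_n) : 0 <= dotp u u.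
Proof. by apply: sumr_ge0 => i _; rewrite -expr2 sqr_ge0. Qed.

Lemma enorm_sqr (R : realType) n (u : 'rV[R]_n) : enorm u ^+ 2 = dotp u u.
Proof. by rewrite sqr_sqrtr ?dotp_ge0. Qed.

Lemma normr_sqr_le_dotp (R : realType) n (u : 'rV[R]_n) : `|u| ^+ 2 <= dotp u u.
Proof.
have [->|u0] := eqVneq u 0; first by rewrite normr0 expr0n /= dotp_ge0.
have [[i j] /= uE] : exists i, `|u| = `|u i.1 i.2|.
  by apply: mx_norm_neq0; apply: contra u0 => /eqP/mx_norm_eq0 ->.
rewrite uE real_normK ?num_real// (ord1 i) /dotp (bigD1 j) //= expr2 lerDl.
by apply: sumr_ge0 => k _; rewrite -expr2 sqr_ge0.
Qed.

(** * Lower semicontinuous hulls and convex closures *)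

Lemma lsc_hull_le (R : realType) n (f : 'rV[R]_n -> \bar R) x :
  (lsc_hull f x <= f x)%E.
Proof. by apply: ge_ereal_sup => _ [g [_ gf] <-]. Qed.

Lemma le_lsc_hull (R : realType) n (f g : 'rV[R]_n -> \bar R) :
  (forall x, f x <= g x)%E -> forall x, (lsc_hull f x <= lsc_hull g x)%E.
Proof.
move=> fg x; apply: le_ereal_sup => _ [h [hlsc hf] <-].
by exists h => //; split => // z; exact: le_trans (hf z) (fg z).
Qed.

Lemma convex_closure_le_hull (R : realType) n (f : 'rV[R]_n -> \bar R) x :
  (convex_closure f x <= lsc_hull f x)%E.
Proof. by rewrite /convex_closure; case: asboolP => // _; exact: leNye. Qed.

Lemma convex_closure_le (R : realType) n (f : 'rV[R]_n -> \bar R) x :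
  (convex_closure f x <= f x)%E.
Proof. exact: le_trans (convex_closure_le_hull f x) (lsc_hull_le f x). Qed.

Lemma lsc_cst (R : realType) n (c : \bar R) :
  lower_semicontinuous (fun _ : 'rV[R]_n => c).
Proof. by move=> x a ac; exists setT => //; exact: filterT. Qed.

(** Constants are the lower bounds that survive the closure without any
    convexity, because a constant is its own lower semicontinuous minorant. This
    is how bounds on one closure of [L] reach the other closure, and then [L]. *)
Lemma cst_le_convex_closure (R : realType) n (f : 'rV[R]_n -> \bar R) (c : \bar R) :
  (-oo < c)%E -> (forall x, c <= f x)%E -> forall x, (c <= convex_closure f x)%E.
Proof.
move=> c_fin cf.
have hc x : (c <= lsc_hull f x)%E.
  apply: ereal_sup_ubound; exists (fun=> c) => //; split => //; exact: lsc_cst.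
move=> x; rewrite /convex_closure; case: asboolP => // -[] z.
by rewrite -ltNye (lt_le_trans c_fin).
Qed.

(** The usable half of the formula hull f = liminf f: a bound on [f] at points
    arbitrarily close to [x] bounds every lower semicontinuous minorant at [x]. *)
Lemma lsc_hull_le_near (R : realType) n (f : 'rV[R]_n -> \bar R) x (c : R) :
  (forall e : R, 0 < e -> exists2 x', `|x' - x| < e & (f x' <= (c + e)%:E)%E) ->
  (lsc_hull f x <= c%:E)%E.
Proof.
move=> Hf; apply: ge_ereal_sup => _ [g [glsc gf] <-].
apply/lee_addgt0Pr => e e0; rewrite leNgt -EFinD; apply/negP => /glsc[V].
move=> /nbhs_ballP[d /= d0 dV] gV.
have [] := Hf (Num.min e d); first by rewrite lt_min e0.
move=> x' x'x fx'; have /gV : V x'.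
  by apply: dV; rewrite -ball_normE /= distrC (lt_le_trans x'x)// ge_min lexx orbT.
apply/negP; rewrite -leNgt (le_trans (gf _))// (le_trans fx')//.
by rewrite lee_fin lerD2l ge_min lexx.
Qed.

Lemma lsc_addr_continuous (R : realType) n (g : 'rV[R]_n -> \bar R)
    (q : 'rV[R]_n -> R) :
  lower_semicontinuous g -> continuous q ->
  lower_semicontinuous (fun x => g x + (q x)%:E)%E.
Proof.
move=> glsc qc x b; rewrite -lteBlDr// => bq.
have [e e0 /glsc[V xV gV]] : exists2 e : R, 0 < e & ((b - q x + e)%:E < g x)%E.
  move: bq; case: (g x) => [r| |] //=; rewrite ?lte_fin => br.
    by exists ((r - (b - q x)) / 2); [lra|rewrite lte_fin; lra].
  by exists 1 => //; rewrite ltry.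
have /cvgrPdist_lt /(_ e e0) qV := qc x.
exists (V `&` [set y | `|q x - q y| < e]); first exact: filterI.
move=> y [/= /gV gy qy]; rewrite -lteBlDr//; apply: le_lt_trans gy.
by rewrite -EFinB lee_fin; move: qy; rewrite ltr_norml => /andP[? ?]; lra.
Qed.

(** Adding [q] maps the lower semicontinuous minorants of [f] to those of
    [f + q], and adding [- q] maps them back. *)
Lemma lsc_hull_addr_continuous (R : realType) n (f : 'rV[R]_n -> \bar R)
    (q : 'rV[R]_n -> R) : continuous q ->
  forall x, lsc_hull (fun x => f x + (q x)%:E)%E x = (lsc_hull f x + (q x)%:E)%E.
Proof.
have ge p (h : 'rV[R]_n -> \bar R) : continuous p -> forall x,
    (lsc_hull h x + (p x)%:E <= lsc_hull (fun x => h x + (p x)%:E) x)%E.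
  move=> pc x; rewrite -leeBrDr//; apply: ge_ereal_sup => _ [g [glsc gh] <-].
  rewrite leeBrDr//; apply: ereal_sup_ubound.
  exists (fun x => g x + (p x)%:E)%E => //; split; first exact: lsc_addr_continuous.
  by move=> z; rewrite leeD2rE.
move=> qc x; apply/eqP; rewrite eq_le ge// andbT -leeBlDr//.
have nqc : continuous (fun x => - q x) by move=> z; exact: continuousN (qc z).
apply: le_trans (ge _ (fun x => f x + (q x)%:E)%E nqc x) _.
by apply: le_lsc_hull => z; rewrite -addeA -EFinD subrr adde0.
Qed.

Lemma convex_closure_addr_continuous (R : realType) n (f : 'rV[R]_n -> \bar R)
    (q : 'rV[R]_n -> R) : continuous q -> forall x,
  convex_closure (fun x => f x + (q x)%:E)%E x = (convex_closure f x + (q x)%:E)%E.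
Proof.
move=> qc x; rewrite /convex_closure.
have -> : (forall x, lsc_hull (fun x => f x + (q x)%:E)%E x != -oo%E) =
          (forall x, lsc_hull f x != -oo%E).
  apply/propext; split=> H z; move: (H z); rewrite lsc_hull_addr_continuous//.
    by case: (lsc_hull f z).
  by case: (lsc_hull f z).
by case: asboolP => // _; rewrite lsc_hull_addr_continuous.
Qed.

(** * Strong convexity *)

(** The strong convexity inequality written with real upper bounds of the two
    values, that is, on the epigraph. No sum of infinities occurs, and the
    property visibly passes to suprema and to sums with real convex functions. *)
Definition epi_strongly_convex (R : realType) n (a : R) (f : 'rV[R]_n -> \bar R) :=
  forall (x x' : 'rV[R]_n) (r r' t : R), 0 < t < 1 ->
    (f x <= r%:E)%E -> (f x' <= r'%:E)%E ->
    (f (t *: x + (1 - t) *: x')%R <=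
      (t * r + (1 - t) * r' - 2^-1 * a * t * (1 - t) * dotp (x - x') (x - x'))%:E)%E.

Lemma strongly_convex_epi (R : realType) n (a : R) (f : 'rV[R]_n -> \bar R) :
  strongly_convex a f -> epi_strongly_convex a f.
Proof.
move=> sc x x' r r' t t01 fr fr'.
have /andP[t0 t1] := t01.
have ft : (t%:E * f x <= (t * r)%:E)%E by rewrite EFinM lee_pmul2l// lte_fin.
have ft' : ((1 - t)%:E * f x' <= ((1 - t) * r')%:E)%E.
  by rewrite EFinM lee_pmul2l// lte_fin subr_gt0.
apply: le_trans (sc x x' t t01 _) _.
  apply: ltpinfty_adde_def; rewrite inE; first exact: le_lt_trans ft (ltry _).
  exact: le_lt_trans ft' (ltry _).
rewrite enorm_sqr [leRHS]EFinB; apply: leeB => //.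
by rewrite [leRHS]EFinD; apply: leeD.
Qed.

Lemma dotp_convex_combination (R : realType) n (t : R) (x x' : 'rV[R]_n) :
  dotp (t *: x + (1 - t) *: x') (t *: x + (1 - t) *: x') =
  t * dotp x x + (1 - t) * dotp x' x' - t * (1 - t) * dotp (x - x') (x - x').
Proof. rewrite !dotpE (dotpC x' x); ring. Qed.

Lemma epi_strongly_convex_add_sqr (R : realType) n (a k b : R)
    (f : 'rV[R]_n -> \bar R) p :
  0 <= k -> epi_strongly_convex a f ->
  epi_strongly_convex a (fun x => f x + (k * dotp (x - p) (x - p) + b)%:E)%E.
Proof.
move=> k0 fsc x x' r r' t t01; rewrite -!leeBrDr// -!EFinB => fr fr'.
have /andP[t0 t1] := t01.
apply: le_trans (fsc x x' _ _ t t01 fr fr') _; rewrite lee_fin.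
have -> : t *: x + (1 - t) *: x' - p = t *: (x - p) + (1 - t) *: (x' - p).
  by apply/rowP => i; rewrite !mxE; ring.
rewrite dotp_convex_combination.
have -> : x - p - (x' - p) = x - x' by rewrite opprB addrA subrK.
have : 0 <= k * (t * (1 - t) * dotp (x - x') (x - x')).
  by rewrite !mulr_ge0 ?dotp_ge0// ?ltW// subr_gt0.
lra.
Qed.

(** Compactness bounds [f] below by some [N0] on the unit ball around [x0]. A
    point at distance [r > 1] from [x0] is compared with the point where its
    segment to [x0] meets the unit sphere: strong convexity gives
    f x >= f x0 - r (f x0 - N0) + a/2 r (r - 1), whose quadratic term wins. *)
Lemma epi_strongly_convex_bounded_below (R : realType) n (a : R)
    (f : 'rV[R]_n -> \bar R) x0 : 0 < a -> epi_strongly_convex a f ->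
  (f x0 < +oo)%E -> (forall x, lsc_hull f x != -oo%E) ->
  exists N : R, forall x, (N%:E <= f x)%E.
Proof.
move=> a0 fsc fx0 hf.
have [N0 HN0] : exists N : R, forall x, `|x - x0| <= 1 -> (N%:E <= f x)%E.
  have cB : compact [set x : 'rV[R]_n | `|x0 - x| <= 1].
    apply: bounded_closed_compact; last first.
      rewrite -/(closed_ball_ Num.norm x0 1).
      by rewrite -closed_ballE//; exact: closed_ball_closed.
    exists (`|x0| + 1); split; first by rewrite num_real.
    move=> M HM x /= xx0; rewrite (le_trans _ (ltW HM))//.
    rewrite -lerBlDl (le_trans _ xx0)// distrC.
    exact: lerB_dist.
  move/compact_near_coveringP: cB.
  move=> /(_ R (pinfty_nbhs R) (fun M x => ((- M)%:E <= f x)%E) _) [].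
    move=> x _.
    have : (-oo < lsc_hull f x)%E by rewrite ltNye.
    move=> /ereal_sup_gt[_ [g [glsc gf] <-]] gx.
    have [r rg] : exists r : R, (r%:E < g x)%E.
      move: gx; case: (g x) => [r| |] // _; last by exists 0; rewrite ltry.
      by exists (r - 1); rewrite lte_fin; lra.
    have [V xV gV] := glsc _ _ rg.
    exists (V, [set M | - r < M]) => /=.
      by split => //; apply: nbhs_pinfty_gt; rewrite num_real.
    move=> [y M] /= [/gV gy rM]; rewrite (le_trans _ (gf y))// (le_trans _ (ltW gy))//.
    by rewrite lee_fin lerNl ltW.
  move=> M [_ HM].
  exists (- (M + 1)) => x xx0; apply: HM => /=; first by rewrite ltrDl.
  by rewrite distrC.
have [f0 f0E] : exists f0 : R, f x0 = f0%:E.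
  move: fx0 (HN0 x0); rewrite subrr normr0 ler01; case: (f x0) => [r| |]//.
    by exists r.
  by move=> _ /(_ isT).
have f0N : N0 <= f0 by rewrite -lee_fin -f0E HN0// subrr normr0.
pose K := f0 - N0 + a / 2.
(* The lower bound f0 - K r + a/2 r^2 is smallest at r = K / a, with value
   f0 - K^2 / (2 a); subtracting K > 0 more makes the contradiction strict. *)
exists (f0 - K ^+ 2 / (2 * a) - K) => x; rewrite leNgt; apply/negP => fx.
have K0 : 0 < K by rewrite /K; lra.
have K2 : 0 <= K ^+ 2 / (2 * a) by rewrite divr_ge0 ?sqr_ge0// mulr_ge0// ltW.
have [xx0|x0x] := leP `|x - x0| 1.
  by have := le_lt_trans (HN0 x xx0) fx; rewrite lte_fin /K; rewrite /K in K2; lra.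
set r := `|x - x0| in x0x.
have r0 : 0 < r by rewrite (lt_trans _ x0x).
have t01 : 0 < r^-1 < 1 by rewrite invr_gt0 r0 invf_lt1.
have fx0' : (f x0 <= f0%:E)%E by rewrite f0E.
have := fsc x x0 _ _ _ t01 (ltW fx) fx0'.
have zB : `|r^-1 *: x + (1 - r^-1) *: x0 - x0| <= 1.
  have -> : r^-1 *: x + (1 - r^-1) *: x0 - x0 = r^-1 *: (x - x0).
    by apply/rowP => i; rewrite !mxE; ring.
  by rewrite normrZ gtr0_norm ?invr_gt0// -/r mulVf// gt_eqF.
move/(le_trans (HN0 _ zB)); rewrite lee_fin.
have := normr_sqr_le_dotp (x - x0); rewrite -/r; set D := dotp _ _ => rD H.
have {}H : r * N0 <= f0 - K ^+ 2 / (2 * a) - K + (r - 1) * f0 - a / 2 * (r - 1) * r.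
  have rN : r * r^-1 = 1 by rewrite mulfV// gt_eqF.
  have {}H := ler_wpM2l (ltW r0) H.
  have H2 : a / 2 * (1 - r^-1) * r ^+ 2 <= a / 2 * (1 - r^-1) * D.
    apply: ler_wpM2l => //; rewrite mulr_ge0 ?subr_ge0//.
      exact: divr_ge0 (ltW a0) _.
    by case/andP: t01 => _ /ltW.
  have E1 : a / 2 * (1 - r^-1) * r ^+ 2 = a / 2 * (r - 1) * r.
    by rewrite -rN; field; rewrite gt_eqF.
  rewrite -E1; apply: le_trans H _; rewrite -subr_ge0; move: H2; rewrite -subr_ge0.
  by congr (0 <= _); field; rewrite !gt_eqF.
have : 0 <= a / 2 * (r - K / a) ^+ 2 by rewrite mulr_ge0 ?sqr_ge0// divr_ge0// ltW.
have -> : a / 2 * (r - K / a) ^+ 2 = a / 2 * r ^+ 2 - r * K + K ^+ 2 / (2 * a).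
  by field; rewrite gt_eqF.
by move: H K0; rewrite /K; lra.
Qed.

Lemma continuous_dotp_sqr (R : realType) n (p : 'rV[R]_n) :
  continuous (fun x : 'rV[R]_n => dotp (x - p) (x - p)).
Proof.
move=> x; rewrite /dotp; apply: (@cvg_big _ _ _ _ _ add_continuous _ (nbhs x)) => i _.
have ci : (fun y : 'rV[R]_n => (y - p) ord0 i) y @[y --> x] --> (x - p) ord0 i.
  have -> : (fun y : 'rV[R]_n => (y - p) ord0 i) =
      (fun y => y ord0 i) \- (fun=> p ord0 i) by apply/funext => y; rewrite !mxE.
  rewrite !mxE; apply: (@cvgB _ _ _ (nbhs x)); last exact: cvg_cst.
  exact: (@coord_continuous _ _ _ ord0 i x).
exact: cvgM.
Qed.

Lemma continuous_quadratic (R : realType) n (k b : R) (p : 'rV[R]_n) :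
  continuous (fun x : 'rV[R]_n => k * dotp (x - p) (x - p) + b).
Proof.
move=> x; apply: (@cvgD _ _ _ (nbhs x)); last exact: cvg_cst.
apply: (@cvgM _ _ (nbhs x)); first exact: cvg_cst.
exact: continuous_dotp_sqr.
Qed.

(** The midpoint inequality makes minimizing sequences Cauchy, with a limit
    [x0]; the same inequality between any [x] and the sequence yields the
    quadratic growth around [x0]. The hull takes the place of [f] at [x0] since
    [f] need not be lower semicontinuous. *)
Lemma epi_strongly_convex_minimizer (R : realType) n (a m : R)
    (f : 'rV[R]_n -> \bar R) : 0 < a -> epi_strongly_convex a f ->
  (forall x, m%:E <= f x)%E ->
  (forall e : R, 0 < e -> exists x, (f x <= (m + e)%:E)%E) ->
  exists x0, (lsc_hull f x0 <= m%:E)%E /\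
    forall x, ((m + 4^-1 * a * dotp (x - x0) (x - x0))%:E <= f x)%E.
Proof.
move=> a0 fsc mf inf.
have [u uP] : {u & forall k : nat, (f (u k) <= (m + k.+1%:R^-1)%:E)%E}.
  have u_ex (k : nat) : exists x, (f x <= (m + k.+1%:R^-1)%:E)%E.
    by apply: inf; rewrite invr_gt0.
  exact: choice u_ex.
have key x r k : (f x <= r%:E)%E ->
    4^-1 * a * dotp (x - u k) (x - u k) <= r - m + k.+1%:R^-1.
  move=> fr; have h01 : 0 < (2^-1 : R) < 1 by lra.
  have := le_trans (mf _) (fsc x (u k) r _ _ h01 fr (uP k)).
  rewrite lee_fin; set D := dotp _ _; set h := k.+1%:R^-1.
  have -> : 2^-1 * r + (1 - 2^-1) * (m + h) - 2^-1 * a * 2^-1 * (1 - 2^-1) * D =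
    2^-1 * (r + m + h - 4^-1 * a * D) by field.
  lra.
have ucvg : cvgn u.
  apply/cauchy_cvgP/cauchy_exP => e e0.
  have e1 : 0 < a * e ^+ 2 / 8 by rewrite divr_gt0// mulr_gt0// exprn_gt0.
  have [N _ HN] := near_infty_natSinv_lt (PosNum e1).
  exists (u N); exists N => // l /= Nl; rewrite -ball_normE /=.
  rewrite -(@ltr_pXn2r _ 2) ?nnegrE ?(ltW e0)//.
  apply: le_lt_trans (normr_sqr_le_dotp _) _.
  have := key _ _ l (uP N); have := HN _ Nl; have := HN N (leqnn N).
  rewrite /= => H1 H2 H3.
  rewrite -(ltr_pM2l (divr_gt0 a0 (ltr0n _ 4))).
  move: (N.+1%:R^-1) (l.+1%:R^-1) (dotp _ _) H1 H2 H3 => h1 h2 D H1 H2 H3.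
  lra.
have [x0 ux0] : exists x0 : 'rV[R]_n, u @ \oo --> x0 by exact/cvg_ex.
exists x0; split.
  apply: lsc_hull_le_near => e e0.
  near \oo => k; exists (u k).
    rewrite distrC; near: k; move/cvgrPdist_lt : ux0; exact.
  apply: le_trans (uP k) _; rewrite lee_fin lerD2l ltW//.
  by near: k; exact: near_infty_natSinv_lt (PosNum e0).
move=> x; have := mf x; case fx : (f x) => [r| |] // _; last by rewrite leey.
have {}fx : (f x <= r%:E)%E by rewrite fx.
rewrite lee_fin -lerBrDl; apply/ler_addgt0Pr => e e0.
have Dcvg : 4^-1 * a * dotp (x - u k) (x - u k) @[k --> \oo] -->
    4^-1 * a * dotp (x - x0) (x - x0).
  apply: cvgM; first exact: cvg_cst.
  have sqN (y : 'rV[R]_n) : dotp (x - y) (x - y) = dotp (y - x) (y - x).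
    by rewrite -opprB dotpNl dotpNr opprK.
  rewrite sqN; under eq_cvg do rewrite sqN.
  apply: (@continuous_cvg _ _ _ _ _ u (fun y => dotp (y - x) (y - x)) x0) => //.
  exact: continuous_dotp_sqr.
have e2 : 0 < e / 2 by rewrite divr_gt0.
near \oo => k.
have : `|4^-1 * a * dotp (x - x0) (x - x0) - 4^-1 * a * dotp (x - u k) (x - u k)|
    < e / 2.
  by near: k; move/cvgrPdist_lt : Dcvg; exact.
move/(le_lt_trans (ler_norm _)) => H1.
have H2 : k.+1%:R^-1 < e / 2 by near: k; exact: near_infty_natSinv_lt (PosNum e2).
have := key x r k fx.
move: (k.+1%:R^-1) (_ * dotp (x - u k) _) (_ * dotp (x - x0) _) H1 H2 => h D D0; lra.
Unshelve. all: by end_near. Qed.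

(** A tangent minorant of [f] at [x], even one weakened by a concave quadratic
    error, forces the sharp strongly convex minorant: the error is quadratic
    along the segment to [x'], hence disappears after dividing by [t] and letting
    [t] tend to 0. With [b = 0] this sharpens subgradients; with [b = 1 / c] it
    turns minimality of f + 1/(2c) |. - p|^2 into a subgradient of [f]. *)
Lemma epi_strongly_convex_tangent (R : realType) n (a b r : R)
    (f : 'rV[R]_n -> \bar R) x z :
  epi_strongly_convex a f -> f x = r%:E ->
  (forall x', (r + dotp (x' - x) z - 2^-1 * b * dotp (x' - x) (x' - x))%:E <= f x')%E ->
  (forall x', (r + dotp (x' - x) z + 2^-1 * a * dotp (x' - x) (x' - x))%:E <= f x')%E.
Proof.
move=> fsc fx ftan x'; have := ftan x'.
case fx' : (f x') => [s| |] //; last by move=> _; rewrite leey.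
move=> _; rewrite lee_fin; apply/ler_addgt0Pr => e e0.
set d := x' - x; pose C := (a + b) / 2 * dotp d d.
have C0 : 0 < `|C| + 1 by rewrite ltr_pwDr.
pose t := Num.min 2^-1 (e / (`|C| + 1)).
have t0 : 0 < t by rewrite lt_min divr_gt0// andbT invr_gt0.
have t1 : t < 1.
  by rewrite gt_min; apply/orP; left; rewrite invf_lt1 ?ltr1n.
have tC : t * C <= e.
  apply: le_trans (_ : t * (`|C| + 1) <= e).
    by rewrite ler_wpM2l ?(ltW t0)// (le_trans (ler_norm _))// lerDl.
  by rewrite -ler_pdivlMr// ge_min lexx orbT.
have t01 : 0 < t < 1 by rewrite t0.
have fx's : (f x' <= s%:E)%E by rewrite fx'.
have fxr : (f x <= r%:E)%E by rewrite fx.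
have := le_trans (ftan _) (fsc x' x s r t t01 fx's fxr).
have -> : t *: x' + (1 - t) *: x - x = t *: d.
  by apply/rowP => i; rewrite !mxE; ring.
rewrite -/d !(dotpZl, dotpZr) lee_fin => H.
have {}H : t * (r + dotp d z + 2^-1 * a * dotp d d) <= t * (s + t * C).
  rewrite -subr_ge0; move: H; rewrite -subr_ge0 /C; congr (0 <= _).
  by move: (dotp d d) => D; field.
by move: H; rewrite ler_pM2l// => /le_trans; apply; rewrite lerD2l.
Qed.

(** * Existence of a saddle point *)

Lemma convex_closure_unbounded (R : realType) n (a : R) (f : 'rV[R]_n -> \bar R) x0 :
  0 < a -> epi_strongly_convex a f -> (f x0 < +oo)%E ->
  ~ (exists N : R, forall x, (N%:E <= f x)%E) -> convex_closure f = cst -oo%E.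
Proof.
move=> a0 fsc fx0 nbd; rewrite /convex_closure; case: asboolP => // hf.
by case: nbd; exact: (epi_strongly_convex_bounded_below a0 fsc fx0).
Qed.

(** If no section were bounded below, every L(., y) would have an improper
    closure, so that [cl1 L] would be identically -oo; then so would be [cl2 (cl1 L) = cl2 L >= L], contrary to
    [-oo < L x0 y0]. *)
Lemma exists_section_bounded_below (R : realType) n m (a : R)
    (L : 'rV[R]_n -> 'rV[R]_m -> \bar R) x0 y0 : 0 < a ->
  (forall y, epi_strongly_convex a (fun x => L x y)) ->
  (forall y, L x0 y < +oo)%E -> (-oo < L x0 y0)%E ->
  cl2 (cl1 L) =2 cl2 L ->
  exists y1 (N : R), forall x, (N%:E <= L x y1)%E.
Proof.
move=> a0 Lsc Lx0 Lx0y0 clL; apply/not_existsP => nbd.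
have cl1Ny : cl1 L = fun _ _ => -oo%E.
  apply/funext => x; apply/funext => y.
  by rewrite /cl1 (convex_closure_unbounded a0 (Lsc y) (Lx0 y) (nbd y)).
have /eqP : cl2 L x0 y0 = -oo%E.
  rewrite -clL cl1Ny /cl2 /concave_closure; apply/eqP.
  rewrite eqe_oppLR /= -leye_eq.
  by apply: (@cst_le_convex_closure _ _ _ +oo%E) => //.
rewrite -leeNy_eq leNgt => /negP; apply; apply: lt_le_trans Lx0y0 _.
by rewrite /cl2 /concave_closure leeNr; exact: convex_closure_le.
Qed.

(** Applied with [G] the maximin value, [ys] the maximizer of inf_x L(x, .) and
    [xs] the limit of the minimizing sequences of L(., ys). An
    approximate minimizer [xt] of L(., t y + (1 - t) ys) satisfies, by concavity,
    (1 - t) L(xt, ys) + t L(xt, y) <= G + t^2. As L(xt, ys) >= G + a/4 |xt - xs|^2,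
    this forces |xt - xs|^2 = O(t) and L(xt, y) <= G + t; then let [t] tend
    to 0. *)
Lemma cl1_le_maximin (R : realType) n m (a G : R)
    (L : 'rV[R]_n -> 'rV[R]_m -> \bar R) x0 xs ys : 0 < a ->
  (forall y, epi_strongly_convex a (fun x => L x y)) ->
  (forall x, epi_strongly_convex a (fun y => - L x y)%E) ->
  (forall y, L x0 y < +oo)%E ->
  (forall y (e : R), 0 < e -> exists x, (L x y <= (G + e)%:E)%E) ->
  (forall x, ((G + 4^-1 * a * dotp (x - xs) (x - xs))%:E <= L x ys)%E) ->
  forall y, (cl1 L xs y <= G%:E)%E.
Proof.
move=> a0 Lsc Lsv Lx0 maximin growth y.
have [[N HN]|nbd] := pselect (exists N : R, forall x, (N%:E <= L x y)%E); last first.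
  by rewrite /cl1 (convex_closure_unbounded a0 (Lsc y) (Lx0 y) nbd) leNye.
apply: le_trans (convex_closure_le_hull _ _) _; apply: lsc_hull_le_near => e e0.
(* t is taken so small that t <= e / 2 and that the bound t K on a/8 |xt - xs|^2
   is less than a/8 e^2. *)
pose K := `|G - N| + 1.
have K0 : 0 < K by rewrite ltr_pwDr.
pose t := Num.min 2^-1 (Num.min (e / 2) (a * e ^+ 2 / (16 * K))).
have t0 : 0 < t.
  by rewrite !lt_min invr_gt0 ltr0n !divr_gt0// !mulr_gt0// exprn_gt0.
have t2 : t <= 2^-1 by rewrite ge_min lexx.
have te : t <= e / 2 by rewrite !ge_min lexx orbT.
have tK : t * K <= a * e ^+ 2 / 16.
  rewrite -ler_pdivlMr// !ge_min; apply/orP; right; apply/orP; right.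
  by rewrite invfM mulrA.
have t01 : 0 < t < 1 by rewrite t0 /= (le_lt_trans t2)// invf_lt1 ?ltr1n.
have [xt Hxt] := maximin (t *: y + (1 - t) *: ys) _ (exprn_gt0 2 t0).
have D0 := dotp_ge0 (xt - xs).
have aD : 0 <= a * dotp (xt - xs) (xt - xs) by rewrite mulr_ge0// ltW.
have key s : (s%:E <= L xt y)%E ->
    t * s + (1 - t) * (G + 4^-1 * a * dotp (xt - xs) (xt - xs)) <= G + t ^+ 2.
  move=> sL.
  have sL' : (- L xt y <= (- s)%:E)%E by rewrite EFinN leeN2.
  have gL' := growth xt; rewrite -leeN2 -EFinN in gL'.
  have := Lsv xt y ys _ _ t t01 sL' gL'.
  rewrite leeNl -EFinN => /le_trans/(_ Hxt); rewrite lee_fin.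
  have : 0 <= 2^-1 * a * t * (1 - t) * dotp (y - ys) (y - ys).
    by rewrite !mulr_ge0 ?dotp_ge0// ?ltW// subr_gt0; case/andP: t01.
  lra.
exists xt.
  rewrite -(@ltr_pXn2r _ 2) ?nnegrE ?(ltW e0)//.
  apply: le_lt_trans (normr_sqr_le_dotp _) _.
  have := key N (HN xt); set D := dotp _ _ in D0 aD *.
  have tt : t ^+ 2 <= t by rewrite expr2 -[leRHS]mulr1 ler_wpM2l ?ltW//; case/andP: t01.
  have tGN : t * (G - N) <= t * `|G - N| by rewrite ler_wpM2l ?ler_norm// ltW.
  have ae : 0 < a * e ^+ 2 by rewrite mulr_gt0// exprn_gt0.
  have taD : t * (a * D) <= 2^-1 * (a * D) by rewrite ler_wpM2r.
  move: tK; rewrite /K mulrDr mulr1 => tK H.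
  by rewrite -(ltr_pM2l a0); lra.
rewrite leNgt; apply/negP => /ltW /key.
have : 0 <= (1 - t) * (4^-1 * a * dotp (xt - xs) (xt - xs)).
  by rewrite mulr_ge0// ?subr_ge0 ?(ltW (proj2 (andP t01)))// -mulrA mulr_ge0.
have : t * t <= t * (e / 2) by rewrite ler_wpM2l// ltW.
have : 0 < t * e by rewrite mulr_gt0.
rewrite expr2; lra.
Qed.

(** The function f(y) = sup_x - L(x, y) inherits strong convexity and its infimum
    [g] is finite by the two bounded sections. Its minimizer [ys] is obtained only
    for the hull of [f], but that suffices: - cl2 L(x, .) lies below the hull
    of [f], so cl2 L(., ys) >= - g, and this constant bound passes to
    [cl1 (cl2 L) = cl1 L <= L]. Dually cl1 L(xs, .) <= - g passes to
    [cl2 (cl1 L) = cl2 L >= L]. *)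
Lemma saddle_point_exists (R : realType) n m (a : R)
    (L : 'rV[R]_n -> 'rV[R]_m -> \bar R) : 0 < a ->
  saddle_proper L -> saddle_closed L ->
  (forall y, epi_strongly_convex a (fun x => L x y)) ->
  (forall x, epi_strongly_convex a (fun y => - L x y)%E) ->
  exists z, saddle_point L z.
Proof.
move=> a0 [x0 [y0 [Lx0 Ly0]]] [[_ cl21] [cl12 _]] Lsc Lsv.
have [y1 [N HN]] := exists_section_bounded_below a0 Lsc Lx0 (Ly0 x0) cl21.
(* The same lemma for the saddle function - L(x, y) of (y, x), whose two closures
   are the opposites of those of L in the other order. *)
have [x1 [N' HN']] : exists x1 (N : R), forall y, (N%:E <= - L x1 y)%E.
  apply: (@exists_section_bounded_below _ _ _ a (fun y x => - L x y)%E y0 x0) => //.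
  - by move=> x; rewrite lteNl.
  - by rewrite lteNr /= Lx0.
  - move=> y x; have := cl12 x y; rewrite /cl1 /cl2 /concave_closure => -> /=.
    by congr (- convex_closure _ _)%E; apply/funext => z; rewrite oppeK.
pose f y := ereal_sup (range (fun x => - L x y)%E).
have Lf x y : (- L x y <= f y)%E by apply: ereal_sup_ubound; exists x.
have fsc : epi_strongly_convex a f.
  move=> y y' r r' t t01 fr fr'; apply: ge_ereal_sup => _ [x _ <-].
  by apply: Lsv => //; [exact: le_trans (Lf x y) fr|exact: le_trans (Lf x y') fr'].
have [g gE] : exists g : R, ereal_inf (range f) = g%:E.
  have : (ereal_inf (range f) <= (- N)%:E)%E.
    apply: (@le_trans _ _ (f y1)); first by apply: ereal_inf_lbound; exists y1.
    by apply: ge_ereal_sup => _ [x _ <-]; rewrite EFinN leeN2.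
  have : (N'%:E <= ereal_inf (range f))%E.
    by apply: le_ereal_inf_tmp => _ [y _ <-]; exact: le_trans (HN' y) (Lf x1 y).
  by case: (ereal_inf _) => // g _ _; exists g.
have gf y : (g%:E <= f y)%E by rewrite -gE; apply: ereal_inf_lbound; exists y.
have [ys [hys _]] : exists ys, (lsc_hull f ys <= g%:E)%E /\
    forall y, ((g + 4^-1 * a * dotp (y - ys) (y - ys))%:E <= f y)%E.
  apply: epi_strongly_convex_minimizer => // e e0.
  have : (ereal_inf (range f) < (g + e)%:E)%E by rewrite gE lte_fin ltrDl.
  by move=> /ereal_inf_lt[_ [y _ <-] /ltW ?]; exists y.
have maximin y (e : R) : 0 < e -> exists x, (L x y <= (- g + e)%:E)%E.
  move=> e0; have : ((g - e)%:E < f y)%E.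
    by apply: lt_le_trans (gf y); rewrite lte_fin gtrDl oppr_lt0.
  move=> /ereal_sup_gt[_ [x _ <-]]; rewrite lteNr -EFinN opprB => /ltW H.
  by exists x; rewrite addrC.
have gL x : ((- g)%:E <= L x ys)%E.
  apply: (@le_trans _ _ (cl1 L x ys)); last exact: convex_closure_le.
  rewrite -cl12; apply: cst_le_convex_closure; first exact: ltNyr.
  move=> x'; rewrite /cl2 /concave_closure EFinN leeN2.
  apply: le_trans (convex_closure_le_hull _ _) _; apply: le_trans hys.
  exact: le_lsc_hull.
have [xs [_ growth]] := epi_strongly_convex_minimizer a0 (Lsc ys) gL (maximin ys).
have Lg y : (L xs y <= (- g)%:E)%E.
  apply: (@le_trans _ _ (cl2 L xs y)).
    by rewrite /cl2 /concave_closure leeNr; exact: convex_closure_le.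
  rewrite -cl21 /cl2 /concave_closure leeNl.
  rewrite -EFinN; apply: cst_le_convex_closure; first exact: ltNyr.
  move=> y'; rewrite EFinN leeN2.
  exact: (cl1_le_maximin a0 Lsc Lsv Lx0 maximin growth).
exists (xs, ys) => x y /=.
by split; [exact: le_trans (Lg y) (gL xs)|exact: le_trans (Lg ys) (gL x)].
Qed.

(** * The resolvent of the saddle operator *)

Definition add_real_saddle (R : realType) n m (L : 'rV[R]_n -> 'rV[R]_m -> \bar R)
    (w : 'rV[R]_n -> 'rV[R]_m -> R) : 'rV[R]_n -> 'rV[R]_m -> \bar R :=
  fun x y => (L x y + (w x y)%:E)%E.

Lemma cl1_add_real (R : realType) n m (L : 'rV[R]_n -> 'rV[R]_m -> \bar R)
    (w : 'rV[R]_n -> 'rV[R]_m -> R) : (forall y, continuous (w^~ y)) ->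
  cl1 (add_real_saddle L w) = add_real_saddle (cl1 L) w.
Proof.
move=> wc; apply/funext => x; apply/funext => y.
by rewrite /cl1 /add_real_saddle (convex_closure_addr_continuous _ (wc y)).
Qed.

Lemma cl2_add_real (R : realType) n m (L : 'rV[R]_n -> 'rV[R]_m -> \bar R)
    (w : 'rV[R]_n -> 'rV[R]_m -> R) : (forall x, continuous (w x)) ->
  cl2 (add_real_saddle L w) = add_real_saddle (cl2 L) w.
Proof.
move=> wc; apply/funext => x; apply/funext => y.
rewrite /cl2 /concave_closure /add_real_saddle.
have -> : (fun z => - (L x z + (w x z)%:E))%E = (fun z => - L x z + (- w x z)%:E)%E.
  by apply/funext => z; rewrite fin_num_oppeD.
have nwc : continuous (fun z => - w x z) by move=> z; exact: continuousN (wc x z).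
by rewrite (convex_closure_addr_continuous _ nwc) fin_num_oppeD// EFinN oppeK.
Qed.

Lemma saddle_closed_add_real (R : realType) n m (L : 'rV[R]_n -> 'rV[R]_m -> \bar R)
    (w : 'rV[R]_n -> 'rV[R]_m -> R) :
  (forall y, continuous (w^~ y)) -> (forall x, continuous (w x)) ->
  saddle_closed L -> saddle_closed (add_real_saddle L w).
Proof.
move=> w1 w2 [[cl11 cl21] [cl12 cl22]].
split; split => x y.
- by rewrite !cl1_add_real// /add_real_saddle cl11.
- by rewrite cl1_add_real// !cl2_add_real// /add_real_saddle cl21.
- by rewrite cl2_add_real// !cl1_add_real// /add_real_saddle cl12.
- by rewrite !cl2_add_real// /add_real_saddle cl22.
Qed.

Definition pdot (R : realType) n m (u v : 'rV[R]_n * 'rV[R]_m) : R :=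
  dotp u.1 v.1 + dotp u.2 v.2.

(** Properness makes [L u.1 u.2] finite, so both subgradient inequalities can be
    sharpened by strong convexity. *)
Lemma saddle_operator_quadratic (R : realType) n m (a : R)
    (L : 'rV[R]_n -> 'rV[R]_m -> \bar R) u g : saddle_proper L ->
  (forall y, epi_strongly_convex a (fun x => L x y)) ->
  (forall x, epi_strongly_convex a (fun y => - L x y)%E) ->
  saddle_operator L u g ->
  exists r : R,
    (forall x, (r + dotp (x - u.1) g.1 + 2^-1 * a * dotp (x - u.1) (x - u.1))%:E
       <= L x u.2)%E /\
    (forall y, (- r + dotp (y - u.2) g.2 + 2^-1 * a * dotp (y - u.2) (y - u.2))%:E
       <= - L u.1 y)%E.
Proof.
move=> [x0 [y0 [Lx0 Ly0]]] Lsc Lsv Tug.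
have [r rE] : exists r : R, L u.1 u.2 = r%:E.
  have [] := Tug x0 y0; move: (Lx0 u.2) (Ly0 u.1).
  case: (L u.1 u.2) => [r _ _ _ _| |]; first by exists r.
    by case: (L x0 u.2).
  by case: (L u.1 y0).
exists r; split.
  apply: (@epi_strongly_convex_tangent _ _ _ 0 _ _ _ _ (Lsc u.2) rE) => x.
  have [_] := Tug x u.2; rewrite rE leeBrDr// -EFinD => H.
  by rewrite mulr0 mul0r subr0.
have nrE : (- L u.1 u.2 = (- r)%:E)%E by rewrite rE EFinN.
apply: (@epi_strongly_convex_tangent _ _ _ 0 _ _ _ _ (Lsv u.1) nrE) => y.
have [+ _] := Tug u.1 y; rewrite rE leeBlDr// -EFinD dotpNr => H.
by rewrite mulr0 mul0r subr0 leeNr -EFinN opprD opprK.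
Qed.

(** Add the sharpened inequalities at [u] and [u'], each evaluated at the
    coordinates of the other point; the cross values L(u.1, u'.2) and
    L(u'.1, u.2) cancel. *)
Lemma saddle_operator_strongly_monotone (R : realType) n m (a : R)
    (L : 'rV[R]_n -> 'rV[R]_m -> \bar R) u g u' g' : saddle_proper L ->
  (forall y, epi_strongly_convex a (fun x => L x y)) ->
  (forall x, epi_strongly_convex a (fun y => - L x y)%E) ->
  saddle_operator L u g -> saddle_operator L u' g' ->
  a * pdot (u - u') (u - u') <= pdot (u - u') (g - g').
Proof.
move=> Lp Lsc Lsv Tu Tu'.
have [r [rx ry]] := saddle_operator_quadratic Lp Lsc Lsv Tu.
have [r' [rx' ry']] := saddle_operator_quadratic Lp Lsc Lsv Tu'.
have h1 := le_trans (rx u'.1) _; have h2 := ry' u.2.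
rewrite leeNr -EFinN in h2; have {h1 h2} := h1 _ h2.
have h1 := le_trans (rx' u.1) _; have h2 := ry u'.2.
rewrite leeNr -EFinN in h2; have {h1 h2} := h1 _ h2.
rewrite !lee_fin /pdot /= -!(opprB u.1 u'.1) -!(opprB u.2 u'.2).
rewrite !(dotpNl, dotpNr, opprK).
rewrite (dotpDr g.1) (dotpDr g.2) !dotpNr; lra.
Qed.

(** This one inequality gives that the resolvent is single-valued (take [w = w'])
    and, at a fixed point [v' = w'], the contraction used for the iteration. *)
Lemma resolvent_strongly_monotone (R : realType) n m (a c : R)
    (L : 'rV[R]_n -> 'rV[R]_m -> \bar R) w v w' v' : saddle_proper L ->
  (forall y, epi_strongly_convex a (fun x => L x y)) ->
  (forall x, epi_strongly_convex a (fun y => - L x y)%E) -> 0 < c ->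
  resolvent c (saddle_operator L) w v -> resolvent c (saddle_operator L) w' v' ->
  (1 + c * a) * pdot (v - v') (v - v') <= pdot (v - v') (w - w').
Proof.
move=> Lp Lsc Lsv c0 [g Tg ->] [g' Tg' ->].
have := saddle_operator_strongly_monotone Lp Lsc Lsv Tg Tg'.
have -> : v + c *: g - (v' + c *: g') = (v - v') + c *: (g - g').
  by rewrite scalerBr opprD addrACA.
have -> : pdot (v - v') (v - v' + c *: (g - g')) =
    pdot (v - v') (v - v') + c * pdot (v - v') (g - g').
  by rewrite /pdot dotpDr (dotpDr (v - v').2) !dotpZr; ring.
move/(ler_wpM2l (ltW c0)); lra.
Qed.

Lemma pdot_le0_eq0 (R : realType) n m (u : 'rV[R]_n * 'rV[R]_m) :
  pdot u u <= 0 -> u = 0.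
Proof.
rewrite /pdot => u0.
have d1 := dotp_ge0 u.1; have d2 := dotp_ge0 u.2.
have z k (v : 'rV[R]_k) : dotp v v <= 0 -> v = 0.
  move=> v0; apply/eqP; rewrite -normr_eq0 -sqrf_eq0 eq_le sqr_ge0 andbT.
  exact: le_trans (normr_sqr_le_dotp v) v0.
case: u u0 d1 d2 => u1 u2 /= u0 d1 d2.
have u10 : u1 = 0 by apply: z; lra.
have u20 : u2 = 0 by apply: z; lra.
by rewrite u10 u20.
Qed.

(** The resolvent at (p, q) consists of the saddle points of
    L(x, y) + 1/(2c) |x - p|^2 - 1/(2c) |y - q|^2. A finite continuous
    perturbation preserves properness and closedness, so a saddle point exists,
    and its minimality in [x] and maximality in [y] become subgradients of [L]. *)
Lemma resolvent_nonempty (R : realType) n m (a c : R)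
    (L : 'rV[R]_n -> 'rV[R]_m -> \bar R) w : 0 < a ->
  saddle_proper L -> saddle_closed L ->
  (forall y, epi_strongly_convex a (fun x => L x y)) ->
  (forall x, epi_strongly_convex a (fun y => - L x y)%E) -> 0 < c ->
  exists v, resolvent c (saddle_operator L) w v.
Proof.
move=> a0 Lp Lcl Lsc Lsv c0; case: w => p q.
pose k := (2 * c)^-1.
have k0 : 0 <= k by rewrite invr_ge0 mulr_ge0// ltW.
pose P x y := k * dotp (x - p) (x - p) - k * dotp (y - q) (y - q).
have Pc1 y : continuous (P^~ y) by exact: continuous_quadratic.
have Pc2 x : continuous (P x).
  have -> : P x = fun y => - k * dotp (y - q) (y - q) + k * dotp (x - p) (x - p).
    by apply/funext => y; rewrite /P mulNr addrC.
  exact: continuous_quadratic.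
have Mp : saddle_proper (add_real_saddle L P).
  have [x0 [y0 [Lx0 Ly0]]] := Lp; exists x0, y0; rewrite /add_real_saddle; split => z.
    by rewrite lte_add_pinfty// ltry.
  by move: (Ly0 z); case: (L z y0) => //= *; rewrite ltNyr.
have Msc y : epi_strongly_convex a (fun x => add_real_saddle L P x y).
  exact: epi_strongly_convex_add_sqr.
have Msv x : epi_strongly_convex a (fun y => - add_real_saddle L P x y)%E.
  have -> : (fun y => - add_real_saddle L P x y)%E =
      (fun y => - L x y + (k * dotp (y - q) (y - q) + - (k * dotp (x - p) (x - p)))%:E)%E.
    apply/funext => y; rewrite /add_real_saddle fin_num_oppeD//; congr (_ + _)%E.
    by rewrite -EFinN opprB.
  exact: epi_strongly_convex_add_sqr.
have Mcl := saddle_closed_add_real Pc1 Pc2 Lcl.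
have [[x y] xyP] := saddle_point_exists a0 Mp Mcl Msc Msv.
have [r rE] : exists r : R, L x y = r%:E.
  have [x0 [y0 [Lx0 Ly0]]] := Lp.
  have [] := xyP x0 y0; rewrite /add_real_saddle /=; move: (Lx0 y) (Ly0 x).
  case: (L x y) => [r _ _ _ _| |]; first by exists r.
    by case: (L x0 y).
  by case: (L x y0).
have tan l (s s' t : 'rV[R]_l) : k * dotp (s - t) (s - t) - k * dotp (s' - t) (s' - t) =
    dotp (s' - s) (c^-1 *: (t - s)) - 2^-1 * c^-1 * dotp (s' - s) (s' - s).
  rewrite !(dotpZr, dotpDl, dotpDr, dotpNl, dotpNr).
  rewrite (dotpC t s) (dotpC t s') (dotpC s' s) /k; field.
  by rewrite gt_eqF.
exists (x, y); exists (c^-1 *: (p - x), c^-1 *: (q - y)); last first.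
  have cK l (s t : 'rV[R]_l) : s = t + c *: (c^-1 *: (s - t)).
    by rewrite scalerA mulfV ?gt_eqF// scale1r addrC subrK.
  by congr (_, _); exact: cK.
have tx x' : ((r + dotp (x' - x) (c^-1 *: (p - x)))%:E <= L x' y)%E.
  have quad x2 : ((r + dotp (x2 - x) (c^-1 *: (p - x)) -
      2^-1 * c^-1 * dotp (x2 - x) (x2 - x))%:E <= L x2 y)%E.
    have [_] := xyP x2 y; rewrite /add_real_saddle /= rE -EFinD -leeBlDr// -EFinB.
    by apply: le_trans; rewrite lee_fin; have := tan _ x x2 p; rewrite /P; lra.
  apply: le_trans (epi_strongly_convex_tangent (Lsc y) rE quad x').
  by rewrite lee_fin lerDl mulr_ge0 ?dotp_ge0// mulr_ge0// ltW.
have ty y' : ((- r + dotp (y' - y) (c^-1 *: (q - y)))%:E <= - L x y')%E.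
  have nrE : (- L x y = (- r)%:E)%E by rewrite rE EFinN.
  have quad y2 : ((- r + dotp (y2 - y) (c^-1 *: (q - y)) -
      2^-1 * c^-1 * dotp (y2 - y) (y2 - y))%:E <= - L x y2)%E.
    have [+ _] := xyP x y2; rewrite /add_real_saddle /= rE -EFinD -leeBrDr// -EFinB => H.
    rewrite leeNr; apply: le_trans H _; rewrite -EFinN lee_fin.
    by have := tan _ y y2 q; rewrite /P; lra.
  apply: le_trans (epi_strongly_convex_tangent (Lsv x) nrE quad y').
  by rewrite lee_fin lerDl mulr_ge0 ?dotp_ge0// mulr_ge0// ltW.
move=> x' y' /=; rewrite rE; split.
  have := ty y'; rewrite leeNr -EFinN => H.
  by rewrite -leeBrDr// -EFinB dotpNr; apply: le_trans H _; rewrite lee_fin; lra.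
by rewrite -leeBlDr// -EFinB opprK.
Qed.

Lemma saddle_point_resolvent (R : realType) n m (c : R)
    (L : 'rV[R]_n -> 'rV[R]_m -> \bar R) z :
  saddle_point L z -> resolvent c (saddle_operator L) z z.
Proof.
move=> zP; exists 0; last by rewrite scaler0 addr0.
by move=> x y; rewrite /= oppr0 !dotp0 !sube0; exact: zP.
Qed.

(** * Asynchronous iterations of a block contraction *)

(** The errors stay below [M] at all times. Once all of them are below
    rho^k M, wait for the delay [d] so that only such values are read, and then
    until each component has been updated once: from then on all are below
    rho^(k+1) M. *)
Lemma async_error_decay (R : realType) (alpha : nat) (rho : R)
    (J : nat -> {set 'I_alpha}) (s : nat -> 'I_alpha -> nat)
    (e : nat -> 'I_alpha -> R) : 0 < rho < 1 ->
  (forall p i, i \notin J p -> e p.+1 i = e p i) ->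
  (forall p i M, 0 < M -> i \in J p -> (forall j, e (s p j) j <= M) ->
    e p.+1 i <= rho * M) ->
  bounded_delays s -> updated_infinitely_often J ->
  forall eps, 0 < eps -> exists P, forall p i, (P <= p)%N -> e p i <= eps.
Proof.
move=> /andP[rho0 rho1] eN eJ [d sd] Jinf eps eps0.
have [M M0 eM] : exists2 M, 0 < M & forall i, e 0%N i <= M.
  exists (1 + \sum_i `|e 0%N i|).
    by rewrite ltr_pwDl// sumr_ge0.
  move=> i; rewrite (bigD1 i)//= addrCA (le_trans (ler_norm _))// lerDl.
  by rewrite addr_ge0// sumr_ge0.
have decay k : exists P, forall p i, (P <= p)%N -> e p i <= rho ^+ k * M.
  elim: k => [|k [P HP]].
    exists 0%N => p i _; rewrite expr0 mul1r.
    elim/ltn_ind: p i => -[|p] IH i //.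
    have [iJ|iJ] := boolP (i \in J p); last by rewrite eN// IH.
    apply: (@le_trans _ _ (rho * M)); last by rewrite ler_piMl// ltW.
    by apply: eJ => // j; apply: IH; have /andP[_] := sd p j; rewrite ltnS.
  have q_ex i : exists q, (P + d <= q)%N /\ i \in J q.
    by have [q] := Jinf i (P + d)%N; exists q.
  have [q qP] := choice q_ex.
  exists (\max_i q i).+1 => p i; rewrite exprS -mulrA => /(leq_ltn_trans (leq_bigmax i)).
  have upd p' : (P + d <= p')%N -> i \in J p' -> e p'.+1 i <= rho * (rho ^+ k * M).
    move=> Pp' iJ; apply: eJ => // [|j]; first by rewrite mulr_gt0// exprn_gt0.
    apply: HP; have /andP[+ _] := sd p' j; apply: leq_trans.
    by rewrite leq_subRL ?(leq_trans (leq_addl _ _) Pp')// addnC.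
  have [Pq iq] := qP i; elim: p => // p IH; rewrite ltnS leq_eqVlt => /orP[/eqP <-|qp].
    exact: upd.
  have [iJ|iJ] := boolP (i \in J p); last by rewrite eN// IH.
  by apply: upd => //; exact: leq_trans Pq (ltnW qp).
have [k kP] : exists k, rho ^+ k * M <= eps.
  have rho_norm : `|rho| < 1 by rewrite gtr0_norm.
  have /cvgrPdist_lt/(_ (eps / M)) := cvg_expr rho_norm.
  rewrite divr_gt0// => /(_ isT) [k _ /(_ k (leqnn k))] /=.
  rewrite sub0r normrN gtr0_norm ?exprn_gt0// ltr_pdivlMr// => /ltW.
  by exists k.
by have [P HP] := decay k; exists P => p i Pp; exact: le_trans (HP p i Pp) kP.
Qed.

Lemma dotp_castmx (R : realType) k k' (E : k = k') (u v : 'rV[R]_k) :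
  dotp (castmx (erefl 1%N, E) u) (castmx (erefl 1%N, E) v) = dotp u v.
Proof. by case: k' / E; rewrite !castmx_id. Qed.

Lemma dotp_mulmx (R : realType) k (u v : 'rV[R]_k) : dotp u v = (u *m v^T) ord0 ord0.
Proof. by rewrite mxE; apply: eq_bigr => i _; rewrite mxE. Qed.

Lemma pdot_blocks (R : realType) n m alpha (nn : 'I_alpha -> nat)
    (nnE : (\sum_(i < alpha) nn i = n + m)%N) (u v : 'rV[R]_n * 'rV[R]_m) :
  pdot u v = \sum_i dotp (to_blocks nnE u i) (to_blocks nnE v i).
Proof.
have -> : pdot u v = dotp (row_mx u.1 u.2) (row_mx v.1 v.2).
  by rewrite /pdot !dotp_mulmx tr_row_mx mul_row_col [RHS]mxE.
rewrite -(dotp_castmx (esym nnE)) /to_blocks.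
move: (castmx _ _) (castmx _ _) => {u v} u v.
rewrite -[in LHS](submxrowK u) -[in LHS](submxrowK v) dotp_mulmx tr_mxrow mul_mxrow_mxcol.
by rewrite summxE; apply: eq_bigr => i _; rewrite dotp_mulmx.
Qed.

Lemma to_blocksB (R : realType) n m alpha (nn : 'I_alpha -> nat)
    (nnE : (\sum_(i < alpha) nn i = n + m)%N) (u v : 'rV[R]_n * 'rV[R]_m) i :
  to_blocks nnE (u - v) i = to_blocks nnE u i - to_blocks nnE v i.
Proof.
apply/rowP => j; rewrite !mxE !castmxE !mxE.
by case: fintype.split => ?; rewrite !mxE.
Qed.

Lemma to_blocksZ (R : realType) n m alpha (nn : 'I_alpha -> nat)
    (nnE : (\sum_(i < alpha) nn i = n + m)%N) k (u : 'rV[R]_n * 'rV[R]_m) i :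
  to_blocks nnE (k *: u) i = k *: to_blocks nnE u i.
Proof.
apply/rowP => j; rewrite !mxE !castmxE !mxE.
by case: fintype.split => ?; rewrite !mxE.
Qed.

Lemma enorm_le (R : realType) k (u : 'rV[R]_k) (M : R) : 0 <= M ->
  (enorm u <= M) = (dotp u u <= M ^+ 2).
Proof.
move=> M0; have u0 : 0 <= enorm u := sqrtr_ge0 _.
by rewrite -enorm_sqr ler_pXn2r ?nnegrE.
Qed.

(** The triangle inequality for positive bounds [A] and [B], obtained from
    |B u - A v|^2 >= 0 without dividing by a norm. *)
Lemma enorm_leD (R : realType) k (u v : 'rV[R]_k) (A B : R) : 0 < A -> 0 < B ->
  enorm u <= A -> enorm v <= B -> enorm (u + v) <= A + B.
Proof.
move=> A0 B0; have A0' := ltW A0; have B0' := ltW B0.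
rewrite !enorm_le ?addr_ge0// => uA vB.
have uv : dotp u v <= A * B.
  rewrite -(ler_pM2l (mulr_gt0 A0 B0)).
  have : 0 <= dotp (B *: u - A *: v) (B *: u - A *: v) := dotp_ge0 _.
  rewrite !dotpE (dotpC v u) => H.
  have H1 := ler_wpM2l (sqr_ge0 B) uA; have H2 := ler_wpM2l (sqr_ge0 A) vB.
  lra.
rewrite !dotpE (dotpC v u); lra.
Qed.

(** The hypothesis on [v] says that it lies in the ball with diameter [0, u / k].
    Each block of [v] is thus within |u| / (2k) <= sqrt alpha M / (2k) of the
    block of u / (2k), itself of size at most M / (2k). Bounding a block of [v] by
    |v| <= |u| / k would only give the factor sqrt alpha / k, which is 1 in the
    limiting case of the theorem. *)
Lemma block_contraction (R : realType) n m alpha (nn : 'I_alpha -> nat)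
    (nnE : (\sum_(i < alpha) nn i = n + m)%N) (k M : R)
    (u v : 'rV[R]_n * 'rV[R]_m) : 0 < k -> 0 < M -> (0 < alpha)%N ->
  k * pdot v v <= pdot v u ->
  (forall i, enorm (to_blocks nnE u i) <= M) ->
  forall i, enorm (to_blocks nnE v i) <= (1 + Num.sqrt alpha%:R) / (2 * k) * M.
Proof.
move=> k0 M0 alpha0 kvu uM i.
pose h := (2 * k)^-1.
have h0 : 0 < h by rewrite invr_gt0 mulr_gt0.
have kh : 2 * k * h = 1 by rewrite mulfV// gt_eqF// mulr_gt0.
set S := Num.sqrt _.
have S0 : 0 < S by rewrite sqrtr_gt0 ltr0n.
have h0' := ltW h0; have S0' := ltW S0; have M0' := ltW M0.
have S2 : S ^+ 2 = alpha%:R by rewrite sqr_sqrtr.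
have uu : pdot u u <= (S * M) ^+ 2.
  have -> : (S * M) ^+ 2 = \sum_(i < alpha) M ^+ 2.
    by rewrite sumr_const card_ord exprMn S2 mulr_natl.
  rewrite (pdot_blocks nnE); apply: ler_sum => j _.
  by rewrite -enorm_le.
pose x := v - h *: u.
have xx : pdot x x <= (h * (S * M)) ^+ 2.
  rewrite exprMn; apply: le_trans (ler_wpM2l (sqr_ge0 h) uu).
  have -> : pdot x x = pdot v v - 2 * h * pdot v u + h ^+ 2 * pdot u u.
    rewrite /pdot /x /= !dotpE (dotpC u.1 v.1) (dotpC u.2 v.2); ring.
  rewrite gerDr subr_le0 -(ler_pM2l k0); apply: le_trans kvu _.
  by rewrite mulrA [k * _]mulrCA mulrA kh mul1r.
have xi : enorm (to_blocks nnE x i) <= h * (S * M).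
  rewrite enorm_le ?mulr_ge0//; apply: le_trans xx.
  rewrite (pdot_blocks nnE) (bigD1 i)//= lerDl.
  by apply: sumr_ge0 => j _; exact: dotp_ge0.
have ui : enorm (h *: to_blocks nnE u i) <= h * M.
  rewrite enorm_le ?mulr_ge0// !dotpE exprMn mulrA -expr2 ler_wpM2l ?sqr_ge0//.
  by rewrite -enorm_le.
have -> : to_blocks nnE v i = to_blocks nnE x i + h *: to_blocks nnE u i.
  by rewrite to_blocksB to_blocksZ subrK.
apply: le_trans (enorm_leD _ _ xi ui) _; rewrite ?mulr_gt0//.
by rewrite -/h; lra.
Qed.

(** * Convergence *)

Lemma cvg_of_blocks (R : realType) n m alpha (nn : 'I_alpha -> nat)
    (nnE : (\sum_(i < alpha) nn i = n + m)%N)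
    (w : nat -> forall i, 'rV[R]_(nn i)) (z : 'rV[R]_n * 'rV[R]_m) :
  (forall eps, 0 < eps -> exists P, forall p i, (P <= p)%N ->
    enorm (w p i - to_blocks nnE z i) <= eps) ->
  (fun p => of_blocks nnE (w p)) @ \oo --> z.
Proof.
move=> wz; apply/cvgrPdist_lt => eps eps0.
pose eta := eps / (alpha%:R + 1).
have eta0 : 0 < eta by rewrite divr_gt0// ltr_wpDl.
have [P HP] := wz eta eta0; exists P => // p /= Pp.
have : pdot (z - of_blocks nnE (w p)) (z - of_blocks nnE (w p)) < eps ^+ 2.
  rewrite (pdot_blocks nnE).
  apply: (@le_lt_trans _ _ (\sum_(i < alpha) eta ^+ 2)).
    apply: ler_sum => i _; rewrite to_blocksB of_blocksK.
    by rewrite -opprB dotpNl dotpNr opprK -enorm_le ?HP// ltW.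
  rewrite sumr_const card_ord -mulr_natl /eta.
  rewrite expr_div_n mulrCA gtr_pMr ?exprn_gt0// ltr_pdivrMr ?exprn_gt0 ?ltr_wpDl// mul1r.
  by have : 0 <= alpha%:R :> R := ler0n _ _; move: (alpha%:R) => al al0; nra.
move=> H; rewrite prod_normE gt_max.
have lt k (x : 'rV[R]_k) : dotp x x < eps ^+ 2 -> `|x| < eps.
  move=> xe; rewrite -(@ltr_pXn2r _ 2) ?nnegrE ?(ltW eps0)//.
  exact: le_lt_trans (normr_sqr_le_dotp x) xe.
have d1 := dotp_ge0 (z - of_blocks nnE (w p)).1.
have d2 := dotp_ge0 (z - of_blocks nnE (w p)).2.
by apply/andP; split; apply: lt; apply: le_lt_trans H; rewrite /pdot ?lerDl ?lerDr.
Qed.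

Theorem corollary4p9 (R : realType) (n m : nat) (a : R)
    (L : 'rV[R]_n -> 'rV[R]_m -> \bar R)
    (alpha : nat) (nn : 'I_alpha -> nat)
    (nnE : (\sum_(i < alpha) nn i = n + m)%N) :
  0 < a ->
  saddle_proper L -> saddle_closed L -> strongly_convex_concave a L ->
  (1 <= alpha)%N ->
  (exists! z : 'rV[R]_n * 'rV[R]_m, saddle_point L z) /\
  (forall c : R, 0 < c -> (Num.sqrt alpha%:R - 1) / a <= c ->
    exists2 F : 'rV[R]_n * 'rV[R]_m -> 'rV[R]_n * 'rV[R]_m,
      forall w, resolvent c (saddle_operator L) w = [set F w] &
      forall z : 'rV[R]_n * 'rV[R]_m, saddle_point L z ->
      forall (J : nat -> {set 'I_alpha}) (s : nat -> 'I_alpha -> nat)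
             (w : nat -> forall i : 'I_alpha, 'rV[R]_(nn i)),
        async_algorithm (fun v => to_blocks nnE (F (of_blocks nnE v))) J s w ->
        bounded_delays s ->
        updated_infinitely_often J ->
        (fun p => of_blocks nnE (w p)) @ \oo --> z).
Proof.
move=> a0 Lp Lcl [Lscx Lscy] alpha0.
have Lsc y : epi_strongly_convex a (fun x => L x y) := strongly_convex_epi (Lscx y).
have Lsv x : epi_strongly_convex a (fun y => - L x y)%E := strongly_convex_epi (Lscy x).
split.
  have [z zP] := saddle_point_exists a0 Lp Lcl Lsc Lsv.
  exists z; split => // z' zP'.
  have /(resolvent_strongly_monotone Lp Lsc Lsv ltr01) := saddle_point_resolvent 1 zP.
  move=> /(_ _ _ (saddle_point_resolvent 1 zP')); rewrite mul1r => H.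
  apply/eqP; rewrite -subr_eq0; apply/eqP/pdot_le0_eq0.
  by rewrite -(pmulr_rle0 _ a0); move: H; lra.
move=> c c0 ac.
have ca0 : 0 < c * a by rewrite mulr_gt0.
have res_ex w : exists v, resolvent c (saddle_operator L) w v.
  exact: (resolvent_nonempty w a0).
have [F FP] := choice res_ex.
exists F => [w|z zP J s w [_ wE] sd Jinf].
  apply/seteqP; split => [v vw|_ ->] //=.
  have := resolvent_strongly_monotone Lp Lsc Lsv c0 vw (FP w).
  rewrite subrr => H; apply/eqP; rewrite -subr_eq0; apply/eqP/pdot_le0_eq0.
  rewrite -(pmulr_rle0 _ (ltr_wpDr (ltW ca0) ltr01)); apply: le_trans H _.
  by rewrite /pdot /= !dotp0 addr0.
pose S : R := Num.sqrt alpha%:R; pose rho := (1 + S) / (2 * (1 + c * a)).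
have S0 : 0 <= S := sqrtr_ge0 _.
have Sca : S <= 1 + c * a.
  by move: ac; rewrite ler_pdivrMr// -/S lerBlDl.
have k0 : 0 < 1 + c * a by rewrite ltr_wpDr// ltW.
have rho01 : 0 < rho < 1.
  rewrite divr_gt0 ?mulr_gt0//= ?ltr_wpDr// ltr_pdivrMr ?mulr_gt0//; lra.
apply: cvg_of_blocks.
apply: (@async_error_decay _ _ rho J s _ rho01) => // [p i iJ|p i M M0 iJ eM].
  by rewrite wE (negPf iJ).
rewrite wE iJ -to_blocksB.
set u := of_blocks nnE _.
apply: (@block_contraction _ _ _ _ _ _ _ _ (u - z)) => //.
  exact: (resolvent_strongly_monotone Lp Lsc Lsv c0 (FP u) (saddle_point_resolvent c zP)).
by move=> j; rewrite to_blocksB of_blocksK.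
Qed.
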